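(* Let $F$ be a formula over $L$, let $E$ be an $\mathcal{E}$-formula over $L$, and let $\sigma$ be a (finite) substitution that corresponds to $E$ (in the sense of the context). Then $\mathrm{FEA}(L)\models F\sigma$ iff $\mathrm{FEA}(L)\models E\rightarrow F$; equivalently, $\mathrm{FEA}(L)\models (\forall)F\sigma\leftrightarrow(\forall)(E\rightarrow F)$.
   Context: $L$ is a first-order language with equality whose function symbols include at least one constant; the variables form a fixed enumerated denumerable set $\mathit{Var}$. $(\forall)G$ denotes the universal closure of $G$; $\mathrm{vars}(G)$ is the set of free variables of $G$; $G_x[t]$ denotes replacement of the free occurrences of $x$ in $G$ by $t$. $\mathrm{FEA}(L)$ (free equality axioms): $f(\bar x)=f(\bar y)\leftrightarrow x_1=y_1\wedge\dots\wedge x_n=y_n$ for each $n$-ary $f$; $f(\bar x)=g(\bar y)\leftrightarrow\mathit{False}$ for distinct $f,g$; $x=t\leftrightarrow\mathit{False}$ whenever $x\not\equiv t$ and $x$ occurs in $t$. An $\mathcal{E}$-formula is built from $\mathit{True}$, $\mathit{False}$ and equations using $\wedge,\exists$; $E\approx E'$ iff $\mathrm{FEA}(L)\models E\leftrightarrow E'$. An $\mathcal{E}$-formula is in solved form if it is $\mathit{True}$, $\mathit{False}$, or $(\exists z_1)\dots(\exists z_m)(x_1=s_1\wedge\dots\wedge x_n=s_n)$ with the $x_i,z_j$ pairwise distinct variables, no $x_i$ occurring in any $s_j$, each $z_j$ occurring in the conjunction, and $z_j\not\equiv s_i$; its parameters are its free variables other than $x_1,\dots,x_n$. Substitutions: a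 finite substitution $\sigma=\{x_1/s_1,\dots,x_n/s_n\}$ maps a finite set $\mathrm{Dom}(\sigma)$ of variables to terms; $\mathrm{Range}(\sigma)$ is the set of variables occurring in the $s_i$; $t\sigma$ is simultaneous replacement; $\sigma\tau$ is composition, $(\sigma\tau)(x)=\sigma(x)\tau$ (defined when $\mathrm{Range}(\sigma)\subseteq\mathrm{Dom}(\tau)$); $\sigma|_X$ is the restriction to $\mathrm{Dom}(\sigma)\cap X$; $\theta$ is a regular extension of $\sigma$ if it extends $\sigma$ and maps $\mathrm{Dom}(\theta)\setminus\mathrm{Dom}(\sigma)$ injectively into variables not in $\mathrm{Range}(\sigma)$. $\sigma\preceq\theta$ iff $\sigma'=\theta'\tau$ for some $\tau$ and some regular extensions $\sigma',\theta'$ of $\sigma,\theta$ with equal domains; $\sigma\approx\theta$ iff both $\sigma\preceq\theta$ and $\theta\preceq\sigma$. Correspondence: $\sigma$ corresponds to $E$ if either $E\approx\mathit{True}$ and $\sigma\approx\emptyset$ (the empty substitution), or $E\approx E'$ for some $\mathcal{E}$-formula $E'\equiv(\exists z_1)\dots(\exists z_m)(x_1=s_1\wedge\dots\wedge x_n=s_n)$ in solved form and $\sigma\approx\{x_1/s_1,\dots,x_n/s_n,y_1/y_1,\dots,y_k/y_k\}$, where $y_1,\dots,y_k$ are the parameters of $E'$. Application $F\sigma$ of a substitution to a formula: first, if $\mathrm{Dom}(\sigma)=\mathrm{vars}(F)$, define by structural induction: for an atom or equation, apply $\sigma$ to all argument terms; $(\neg G)\sigma=\neg(G\sigma)$; $(G\,b\,H)\sigma=G\sigma_1\,b\,H\sigma_2$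 for $b\in\{\wedge,\vee,\to,\leftrightarrow\}$ with $\sigma_1=\sigma|_{\mathrm{vars}(G)}$, $\sigma_2=\sigma|_{\mathrm{vars}(H)}$; for $F=(\exists x)G$: if $x\notin\mathrm{Range}(\sigma)$, $F\sigma=(\exists x)(G\sigma')$ where $\sigma'=\sigma\cup\{x/x\}$ if $x\in\mathrm{vars}(G)$ and $\sigma'=\sigma$ otherwise; if $x\in\mathrm{Range}(\sigma)$, let $y$ be the first variable of $\mathit{Var}$ not in $\mathrm{Range}(\sigma)$ and $F\sigma=(\exists y)(G_x[y]\sigma')$ where $\sigma'=\sigma\cup\{y/y\}$ if $x\in\mathrm{vars}(G)$ and $\sigma'=\sigma$ otherwise; $(\forall x)G$ is handled analogously. For arbitrary $\sigma$: let $\sigma'=\sigma|_{\mathrm{vars}(F)}$ and build $\sigma''$ from $\sigma'$ by repeatedly taking the first variable $x$ of $\mathrm{vars}(F)\setminus\mathrm{Dom}(\sigma'')$ and adding $x/y$, where $y=x$ if $x\notin\mathrm{Range}(\sigma'')$ and otherwise $y$ is the first variable not in $\mathrm{Range}(\sigma'')$; then $F\sigma:=F\sigma''$.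
   Formalization: In the renaming case of Fσ, y is the first variable not in Range(σ) that is also substitutable for x in G without capture and, if x ∈ vars(G), not in Dom(σ); with the literal choice of y, Fσ can capture variables or σ∪{y/y} fail to be a substitution, and the claim is false. *)

(* Defs.v *)
From Stdlib Require List.
From mathcomp Require Import all_boot finmap.

Set Implicit Arguments.
Unset Strict Implicit.
Unset Printing Implicit Defensive.

Local Open Scope fset_scope.
Local Open Scope fmap_scope.

(* Variables are natural numbers, enumerated by [v_0, v_1, ...]. *)
Notation var := nat.

Record language := Language {
  fun_sym : Type;
  fun_ar : fun_sym -> nat;
  pred_sym : Type;
  pred_ar : pred_sym -> nat
}.

Section Syntax.
Variable L : language.

Inductive term : Type :=
| Var (x : var)
| App (f : fun_sym L) (a : {ffun 'I_(fun_ar f) -> term}).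

Inductive binop := And | Or | Imp | Iff.
Inductive quantifier := Ex | All.

Inductive formula : Type :=
| Tr
| Fa
| Atom (p : pred_sym L) (a : {ffun 'I_(pred_ar p) -> term})
| Eq (s t : term)
| Not (G : formula)
| Bin (b : binop) (G H : formula)
| Qu (q : quantifier) (x : var) (G : formula).

Fixpoint tvars (t : term) : {fset var} :=
  match t with
  | Var x => [fset x]
  | App f a => \bigcup_(i in 'I_(fun_ar f)) tvars (a i)
  end.

Fixpoint fv (F : formula) : {fset var} :=
  match F with
  | Tr | Fa => fset0
  | Atom p a => \bigcup_(i in 'I_(pred_ar p)) tvars (a i)
  | Eq s t => tvars s `|` tvars t
  | Not G => fv G
  | Bin _ G H => fv G `|` fv H
  | Qu _ x G => fv G `\ x
  end.

Definition uclosure (F : formula) : formula := foldr (Qu All) F (fv F).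

Fixpoint conjs (s : seq formula) : formula :=
  match s with
  | [::] => Tr
  | [:: A] => A
  | A :: s' => Bin And A (conjs s')
  end.

Definition exs (zs : seq var) (F : formula) : formula := foldr (Qu Ex) F zs.

Definition subst := {fmap var -> term}.

Definition rng (s : subst) : {fset var} :=
  \bigcup_(x <- domf s) tvars (odflt (Var x) s.[? x]).

Fixpoint tsubst (s : subst) (t : term) : term :=
  match t with
  | Var x => odflt (Var x) s.[? x]
  | App f a => App [ffun i => tsubst s (a i)]
  end.

(* Only meaningful when [rng s `<=` domf r]. *)
Definition scomp (s r : subst) : subst :=
  [fmap x : domf s => tsubst r (s x)].

Definition regular_extension (s r : subst) : Prop :=
  r.[& domf s] = s /\
  exists h : var -> var,
    {in domf r `\` domf s &, injective h} /\
    {in domf r `\` domf s,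
      forall x, r.[? x] = Some (Var (h x)) /\ h x \notin rng s}.

Definition sle (s r : subst) : Prop :=
  exists s' r' t : subst,
    [/\ regular_extension s s', regular_extension r r', domf s' = domf r',
        rng r' `<=` domf t & s' = scomp r' t].

Definition sequiv (s r : subst) : Prop := sle s r /\ sle r s.

(* [frepl x t F] is F_x[t]; bound variables are not renamed. *)
Fixpoint frepl (x : var) (t : term) (F : formula) : formula :=
  let s : subst := [fmap].[x <- t] in
  match F with
  | Tr => Tr
  | Fa => Fa
  | Atom p a => Atom [ffun i => tsubst s (a i)]
  | Eq u v => Eq (tsubst s u) (tsubst s v)
  | Not G => Not (frepl x t G)
  | Bin b G H => Bin b (frepl x t G) (frepl x t H)
  | Qu q z G => Qu q z (if z == x then G else frepl x t G)
  end.

(* No free occurrence of [x] in [F] lies in the scope of a quantifier on [y]. *)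
Fixpoint free_for (y x : var) (F : formula) : bool :=
  match F with
  | Tr | Fa | Atom _ _ | Eq _ _ => true
  | Not G => free_for y x G
  | Bin _ G H => free_for y x G && free_for y x H
  | Qu q z G => (x \notin fv (Qu q z G)) || (z != y) && free_for y x G
  end.

Lemma fset_bound (A : {fset var}) : exists n, forall y, n <= y -> y \notin A.
Proof.
exists (\max_(a <- A) a).+1 => y; apply: contraTN => yA.
by rewrite -ltnNge ltnS (@leq_bigmax_seq _ (enum_fset A) xpredT id).
Qed.

Lemma free_for_bound (x : var) (G : formula) :
  exists n, forall y, n <= y -> free_for y x G.
Proof.
elim: G => [||p a|s t|G IH|b G [m IHG] H [n IHH]|q z G [n IH]];
  try by exists 0.
- by [].
- exists (m + n)%N => y le_y /=; apply/andP; split.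
    by apply: IHG; apply: leq_trans le_y; apply: leq_addr.
  by apply: IHH; apply: leq_trans le_y; apply: leq_addl.
- exists (z.+1 + n)%N => y le_y /=; apply/orP; right; apply/andP; split.
    by rewrite neq_ltn (leq_trans (leq_addr n z.+1) le_y).
  by apply: IH; apply: leq_trans le_y; apply: leq_addl.
Qed.

Lemma ex_fresh (A : {fset var}) : exists y, y \notin A.
Proof. by have [n] := fset_bound A; exists n; auto. Qed.

Definition first_notin (A : {fset var}) : var := ex_minn (ex_fresh A).

(* The conditions under which (Q y)(G_x[y] s'), with s' equal to s or, if x is
   free in G, to the union of s and {y/y}, makes sense as the result of applying
   s to (Q x)G: y is not in the range of s, the union is a substitution, and y
   is substitutible for x in G. *)
Definition can_rename (s : subst) (x : var) (G : formula) (y : var) : bool :=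
  [&& y \notin rng s, (x \in fv G) ==> (y \notin domf s) & free_for y x G].

Lemma ex_rename (s : subst) (x : var) (G : formula) :
  exists y, can_rename s x G y.
Proof.
have [m Hm] := fset_bound (rng s `|` domf s).
have [n Hn] := free_for_bound x G.
exists (m + n)%N; have := Hm _ (leq_addr n m).
rewrite inE negb_or => /andP[yr yd].
by rewrite /can_rename yr yd implybT Hn ?leq_addl.
Qed.

(* When the first variable outside [rng s] is itself admissible, it is this
   one; otherwise using it would capture or identify variables. *)
Definition rename_var (s : subst) (x : var) (G : formula) : var :=
  ex_minn (ex_rename s x G).

Fixpoint fsize (F : formula) : nat :=
  match F with
  | Tr | Fa | Atom _ _ | Eq _ _ => 1
  | Not G | Qu _ _ G => (fsize G).+1
  | Bin _ G H => (fsize G + fsize H).+1%N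
  end.

(* Application of [s] to [F] when [domf s = fv F].  The recursion is on the
   bound [n], which must be at least [fsize F], because [frepl x (Var y) G]
   is not a subterm of [Qu q x G] (it has the same size as [G]). *)
Fixpoint fapp_rec (n : nat) (F : formula) (s : subst) : formula :=
  if n isn't m.+1 then F else
  match F with
  | Tr => Tr
  | Fa => Fa
  | Atom p a => Atom [ffun i => tsubst s (a i)]
  | Eq u v => Eq (tsubst s u) (tsubst s v)
  | Not G => Not (fapp_rec m G s)
  | Bin b G H =>
      Bin b (fapp_rec m G s.[& fv G]) (fapp_rec m H s.[& fv H])
  | Qu q x G =>
      if x \notin rng s then
        let s' := if x \in fv G then s.[x <- Var x] else s in
        Qu q x (fapp_rec m G s')
      else
        let y := rename_var s x G in
        let s' := if x \in fv G then s.[y <- Var y] else s in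
        Qu q y (fapp_rec m (frepl x (Var y) G) s')
  end.

(* The variables of [V] outside [domf s] are added in increasing order. *)
Definition complete (V : {fset var}) (s : subst) : subst :=
  foldl (fun r x =>
           r.[x <- Var (if x \notin rng r then x else first_notin (rng r))])
        s (sort leq (V `\` domf s)).

Definition fapp (F : formula) (s : subst) : formula :=
  fapp_rec (fsize F) F (complete (fv F) s.[& fv F]).

Record structure := Structure {
  carrier : Type;
  carrier_inhabited : inhabited carrier;
  finterp : forall f : fun_sym L, {ffun 'I_(fun_ar f) -> carrier} -> carrier;
  pinterp : forall p : pred_sym L, {ffun 'I_(pred_ar p) -> carrier} -> Prop
}.

Fixpoint teval (M : structure) (v : var -> carrier M) (t : term) : carrier M :=
  match t with
  | Var x => v x
  | App f a => finterp [ffun i => teval v (a i)]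
  end.

Fixpoint sat (M : structure) (v : var -> carrier M) (F : formula) : Prop :=
  match F with
  | Tr => True
  | Fa => False
  | Atom p a => pinterp [ffun i => teval v (a i)]
  | Eq s t => teval v s = teval v t
  | Not G => ~ sat v G
  | Bin And G H => sat v G /\ sat v H
  | Bin Or G H => sat v G \/ sat v H
  | Bin Imp G H => sat v G -> sat v H
  | Bin Iff G H => sat v G <-> sat v H
  | Qu Ex x G => exists d, sat [eta v with x |-> d] G
  | Qu All x G => forall d, sat [eta v with x |-> d] G
  end.

Definition valid (M : structure) (F : formula) : Prop :=
  forall v : var -> carrier M, sat v F.

Definition entails (T : formula -> Prop) (F : formula) : Prop :=
  forall M : structure, (forall A, T A -> valid M A) -> valid M F.

Definition app_vars (f : fun_sym L) (x : {ffun 'I_(fun_ar f) -> var}) : term :=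
  App [ffun i => Var (x i)].

Inductive FEA : formula -> Prop :=
| FEA_inj (f : fun_sym L) (x y : {ffun 'I_(fun_ar f) -> var}) :
    uniq (codom x ++ codom y) ->
    FEA (Bin Iff (Eq (app_vars x) (app_vars y))
           (conjs [seq Eq (Var (x i)) (Var (y i)) | i <- enum 'I_(fun_ar f)]))
| FEA_clash (f g : fun_sym L)
    (x : {ffun 'I_(fun_ar f) -> var}) (y : {ffun 'I_(fun_ar g) -> var}) :
    f <> g -> uniq (codom x ++ codom y) ->
    FEA (Bin Iff (Eq (app_vars x) (app_vars y)) Fa)
| FEA_occurs (x : var) (t : term) :
    t <> Var x -> x \in tvars t -> FEA (Bin Iff (Eq (Var x) t) Fa).

Fixpoint Eformula (F : formula) : Prop :=
  match F with
  | Tr | Fa | Eq _ _ => True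
  | Bin And G H => Eformula G /\ Eformula H
  | Qu Ex _ G => Eformula G
  | _ => False
  end.

Definition Eequiv (E E' : formula) : Prop := entails FEA (Bin Iff E E').

Definition conj_eqs (eqs : seq (var * term)) : formula :=
  conjs [seq Eq (Var e.1) e.2 | e <- eqs].

(* [exs zs (conj_eqs eqs)] is in solved form; [Tr] and [Fa] are the two other
   solved forms. *)
Definition solved (zs : seq var) (eqs : seq (var * term)) : Prop :=
  [/\ eqs <> [::],
      uniq (zs ++ unzip1 eqs),
      (forall x s, x \in unzip1 eqs -> List.In s (unzip2 eqs) ->
         x \notin tvars s),
      {subset zs <= fv (conj_eqs eqs)} &
      (forall z s, z \in zs -> List.In s (unzip2 eqs) -> s <> Var z)].

Definition parameters (zs : seq var) (eqs : seq (var * term)) : {fset var} :=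
  fv (exs zs (conj_eqs eqs)) `\` [fset x in unzip1 eqs].

(* {x_1/s_1, ..., x_n/s_n, y_1/y_1, ..., y_k/y_k} *)
Definition solved_subst (zs : seq var) (eqs : seq (var * term)) : subst :=
  foldr (fun e r => r.[e.1 <- e.2])
        [fmap y : parameters zs eqs => Var (val y)] eqs.

Definition corresponds (s : subst) (E : formula) : Prop :=
  (Eequiv E Tr /\ sequiv s [fmap]) \/
  exists zs eqs,
    [/\ solved zs eqs, Eequiv E (exs zs (conj_eqs eqs)) &
        sequiv s (solved_subst zs eqs)].

End Syntax.

Arguments FEA : clear implicits.

(* Main.v *)
(** In a structure M, let the cover of a substitution s be the set of assignments
    w with w x = (value of s x under v) on the domain of s, for some assignment v.
    By the substitution lemma F s is valid in M iff F holds on the cover of s.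
    Covers are unchanged by regular extensions, hence are monotone for the
    preorder on substitutions, and the cover of the substitution of a solved
    form is the set of its solutions.  So if s corresponds to E, then in every
    model of FEA the cover of s is the solution set of E.  The free equality
    axioms enter only through E being equivalent to its solved form. *)
From mathcomp Require Import all_boot finmap.
Require Import Defs.

Set Implicit Arguments.
Unset Strict Implicit.
Unset Printing Implicit Defensive.

Local Open Scope fset_scope.
Local Open Scope fmap_scope.

Section Semantics.
Variable L : language.
Implicit Types (t u : term L) (F G H : formula L) (s r : subst L).

(* The generated [term_ind] has no induction hypothesis for the arguments. *)
Lemma term_nested_ind (P : term L -> Prop) :
    (forall x, P (Var L x)) ->
    (forall f (a : {ffun 'I_(fun_ar f) -> term L}),
       (forall i, P (a i)) -> P (App a)) ->
  forall t, P t.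
Proof.
move=> PV PA; fix IH 1; case=> [x|f a]; first exact: PV.
by apply: PA => i; apply: IH.
Qed.

Lemma bigcup_ordP n (A : 'I_n -> {fset var}) x :
  reflect (exists i, x \in A i) (x \in \bigcup_(i in 'I_n) A i).
Proof.
apply: (iffP (bigfcupP _ _ _ _)) => [[i _ xi]|[i xi]]; exists i => //.
by rewrite mem_index_enum.
Qed.

Lemma rngP s y :
  reflect (exists2 x, x \in domf s & y \in tvars (tsubst s (Var L x)))
          (y \in rng s).
Proof.
apply: (iffP (bigfcupP _ _ _ _)) => [[x]|[x xs yx]].
  by rewrite andbT => xs yx; exists x.
by exists x; rewrite ?andbT.
Qed.

(** * Evaluation and satisfaction in a fixed structure *)

Section Structure.
Variable M : structure L.
Implicit Types v w : var -> carrier M.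

Lemma teval_eq v w t : {in tvars t, v =1 w} -> teval v t = teval w t.
Proof.
elim/term_nested_ind: t => [x|f a IH] vw /=; first by apply: vw; rewrite inE.
congr finterp; apply/ffunP => i; rewrite !ffunE; apply: IH => x xi.
by apply: vw; apply/bigcup_ordP; exists i.
Qed.

Lemma sat_bin v w b G H G' H' :
    (sat v G <-> sat w G') -> (sat v H <-> sat w H') ->
  sat v (Bin b G H) <-> sat w (Bin b G' H').
Proof. by case: b => /=; tauto. Qed.

Lemma sat_qu v w q x y G H :
    (forall d, sat [eta v with x |-> d] G <-> sat [eta w with y |-> d] H) ->
  sat v (Qu q x G) <-> sat w (Qu q y H).
Proof.
case: q => /= vw; split.
- by case=> d /vw; exists d.
- by case=> d /vw; exists d.
- by move=> h d; apply/vw.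
- by move=> h d; apply/vw.
Qed.

Lemma sat_eq F v w : {in fv F, v =1 w} -> sat v F <-> sat w F.
Proof.
elim: F v w => [||p a|t u|G IH|b G IHG H IHH|q x G IH] v w vw //.
- rewrite /=.
  suff -> : [ffun i => teval v (a i)] = [ffun i => teval w (a i)] by [].
  apply/ffunP => i; rewrite !ffunE; apply: teval_eq => x xi.
  by apply: vw; apply/bigcup_ordP; exists i.
- rewrite /= (@teval_eq v w t) 1?(@teval_eq v w u) // => x xi;
    by apply: vw; rewrite inE xi ?orbT.
- by rewrite /= (IH v w).
- by apply: sat_bin; [apply: IHG|apply: IHH] => x xi; apply: vw;
    rewrite inE xi ?orbT.
- apply: sat_qu => d; apply: IH => z zG /=; case: eqP => // /eqP zx.
  by apply: vw; rewrite !inE zx.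
Qed.

(** Since [tsubst] leaves variables outside [domf s] unchanged, [asg v s] agrees with [v] there. *)
Definition asg v s : var -> carrier M := fun x => teval v (tsubst s (Var L x)).

Lemma teval_subst v s t : teval v (tsubst s t) = teval (asg v s) t.
Proof.
elim/term_nested_ind: t => [//|f a IH] /=.
by congr finterp; apply/ffunP => i; rewrite !ffunE IH.
Qed.

Lemma sat_uclosure v F : sat v (uclosure F) <-> valid M F.
Proof.
rewrite /uclosure.
have gen (l : seq var) : forall u : var -> carrier M, sat u (foldr (@Qu L All) F l) <->
    forall w, (forall x, x \notin l -> w x = u x) -> sat w F.
  elim: l => [|x l IH] u /=.
    split=> [Fu w wu|]; last exact.
    by apply: (proj2 (@sat_eq F w u _) Fu) => y _; apply: wu.
  split=> [h w wu|h d].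
    apply: (proj1 (IH _) (h (w x))) => y yl /=.
    by case: eqP => [->//|/eqP yx]; apply: wu; rewrite inE negb_or yx.
  apply/IH => w wu; apply: h => y; rewrite inE negb_or => /andP[yx yl].
  by rewrite wu //= (negbTE yx).
split=> [/gen h w|h]; last by apply/gen => w _; apply: h.
(* [u] agrees with [v] off the free variables, so [h] applies to it, and with [w] on them, so [F]
   has the same truth value under both. *)
pose u x := if x \in fv F then w x else v x.
apply: (proj2 (@sat_eq F w u _)) => [x xF|]; first by rewrite /u xF.
by apply: h => x xF; rewrite /u (negbTE xF).
Qed.

Lemma sat_exs v zs F :
  sat v (exs zs F) <-> exists2 w, {in predC (mem zs), w =1 v} & sat w F.
Proof.
elim: zs v => [|z zs IH] v /=.
  split=> [Fv|[w wv Fw]]; first by exists v.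
  by apply: (proj2 (@sat_eq F v w _) Fw) => x _; rewrite wv.
split=> [[d /IH[w wv Fw]]|[w wv Fw]].
  exists w => // x; rewrite !inE negb_or => /andP[xz xzs].
  by rewrite wv //= (negbTE xz).
exists (w z); apply/IH; exists w => // x xzs /=.
case: eqP => [->//|/eqP xz]; apply: wv.
by rewrite !inE negb_or xz.
Qed.

Lemma sat_conj_eqs v eqs :
  sat v (conj_eqs eqs) <-> forall x t, List.In (x, t) eqs -> v x = teval v t.
Proof.
(* [conjs] ends in its last member and not in [Tr], so singletons form a separate case. *)
rewrite /conj_eqs; elim: eqs => [|[x t] [|e eqs] IH] /=.
- by split.
- by split=> [h _ _ [[<- <-]|[]]//|h]; apply: h; left.
split=> [[xt /IH h] y u [[<- <-]//|]|h]; first exact: h.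
by split; [apply: h; left|apply/IH => y u yu; apply: h; right].
Qed.

End Structure.

(** * Replacement of a free variable by a variable *)

Lemma frepl_id x t G : x \notin fv G -> frepl x t G = G.
Proof.
have sid u : x \notin tvars u -> tsubst [fmap].[x <- t] u = u.
  elim/term_nested_ind: u => [y|f a IH] /=; rewrite ?inE => xu.
    by rewrite fnd_set eq_sym (negbTE xu) fnd_fmap0.
  congr App; apply/ffunP => i; rewrite ffunE IH //.
  by apply: contra xu => xi; apply/bigcup_ordP; exists i.
elim: G => [||p a|u w|G IH|b G IHG H IHH|q z G IH] //=; rewrite ?inE.
- move=> xa; congr Atom; apply/ffunP => i; rewrite ffunE sid //.
  by apply: contra xa => xi; apply/bigcup_ordP; exists i.
- by rewrite negb_or => /andP[xu xw]; rewrite !sid.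
- by move=> xG; rewrite IH.
- by rewrite negb_or => /andP[xG xH]; rewrite IHG ?IHH.
- by case: eqVneq => [//|zx] /= xG; rewrite IH.
Qed.

Lemma fsize_frepl x t G : fsize (frepl x t G) = fsize G.
Proof.
by elim: G => [||||G /= ->|b G /= -> H ->|q z G IH] //=; case: eqP => //; rewrite IH.
Qed.

(** With [c] standing for [z != x] and [d] for [z == y], this carries the description of the
    variables after a replacement from the arguments to a term or an atom. *)
Lemma mem_bigcup_repl n (A B : 'I_n -> {fset var}) (x z : var) (c d : bool) :
    (forall i, (z \in B i) = (z \in A i) && c || (x \in A i) && d) ->
  (z \in \bigcup_(i in 'I_n) B i) =
    (z \in \bigcup_(i in 'I_n) A i) && c || (x \in \bigcup_(i in 'I_n) A i) && d.
Proof.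
move=> BA; apply/bigcup_ordP/idP => [[i]|].
  rewrite BA => /orP[/andP[zi ->]|/andP[xi ->]]; rewrite andbT; apply/orP.
    by left; apply/bigcup_ordP; exists i.
  by right; apply/bigcup_ordP; exists i.
by case/orP=> /andP[/bigcup_ordP[i zi] e]; exists i; rewrite BA zi e ?orbT.
Qed.

Lemma mem_tvars_repl x y t z :
  (z \in tvars (tsubst [fmap].[x <- Var L y] t)) =
  (z \in tvars t) && (z != x) || (x \in tvars t) && (z == y).
Proof.
elim/term_nested_ind: t => [w|f a IH] /=; last first.
  by apply: mem_bigcup_repl => i; rewrite ffunE.
rewrite fnd_set fnd_fmap0 !inE (eq_sym x w); have [->|wx] := eqVneq w x.
  by rewrite inE andbN.
by rewrite inE orbF; have [->|//] := eqVneq z w; rewrite wx.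
Qed.

(** Without [free_for], a quantifier on [y] could bind the new occurrences of [y], which would then
    be missing from the free variables. *)
Lemma mem_fv_frepl x y G z : free_for y x G ->
  (z \in fv (frepl x (Var L y) G)) =
  (z \in fv G) && (z != x) || (x \in fv G) && (z == y).
Proof.
elim: G => [||p a|t u|G IH|b G IHG H IHH|q w G IH] //=.
- by move=> _; apply: mem_bigcup_repl => i; rewrite ffunE mem_tvars_repl.
- move=> _; rewrite !inE !mem_tvars_repl.
  by do !case: (_ \in _); do !case: (_ == _).
- case/andP=> /IHG {}IHG /IHH {}IHH; rewrite !inE IHG IHH.
  by do !case: (_ \in _); do !case: (_ == _).
case: (eqVneq w x) => [->|wx] /=.
  by move=> _; rewrite !inE eqxx /= orbF; case: (z == x); rewrite ?andbF ?andbT.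
rewrite !inE (eq_sym x w) wx /=.
have [xG|xG] /= := boolP (x \in fv G); last first.
  rewrite frepl_id //= orbF => _; case: (eqVneq z x) => [->|_]; last by rewrite andbT.
  by rewrite (negbTE xG) andbF.
case/andP=> wy /IH ->; rewrite xG /=.
by case: (eqVneq z y) => [->|]; rewrite ?orbT ?orbF ?andbA // eq_sym wy.
Qed.

Lemma sat_frepl (M : structure L) (v : var -> carrier M) x y G :
  free_for y x G ->
  sat v (frepl x (Var L y) G) <-> sat [eta v with x |-> v y] G.
Proof.
have tE (v0 : var -> carrier M) t : teval v0 (tsubst [fmap].[x <- Var L y] t) =
    teval [eta v0 with x |-> v0 y] t.
  rewrite teval_subst; apply: teval_eq => z _.
  by rewrite /asg /= fnd_set; case: eqP => //; rewrite fnd_fmap0.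
have notfree v0 G' : x \notin fv G' ->
    sat v0 (frepl x (Var L y) G') <-> sat [eta v0 with x |-> v0 y : carrier M] G'.
  move=> xG; rewrite frepl_id //; apply: sat_eq => z zG /=.
  by case: eqP zG xG => // -> ->.
elim: G v => [||p a|t u|G IH|b G IHG H IHH|q z G IH] v.
- by [].
- by [].
- rewrite /=; set A := (X in pinterp X); set B := (X in _ <-> pinterp X).
  suff -> : A = B by [].
  by apply/ffunP => i; rewrite !ffunE tE.
- by rewrite /= !tE.
- by move=> /= /IH ->.
- by case/andP=> /IHG {}IHG /IHH {}IHH; apply: sat_bin.
case/orP=> [/notfree|/andP[zy /IH {}IH]]; first exact.
have [|xG] := boolP (x \in fv (Qu q z G)); last by move/notfree: xG.
rewrite !inE => /andP[xz xG] /=; rewrite eq_sym (negbTE xz).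
(* The updates at [x] and [z] commute since [x] differs from [z], and the update at [z] keeps the
   value of [y] since [z] differs from [y]. *)
apply: sat_qu => d; rewrite IH; apply: sat_eq => w _ /=.
rewrite (eq_sym y) (negbTE zy).
by case: (eqVneq w x) => // ->; rewrite (negbTE xz).
Qed.

(** * The substitution lemma *)

Lemma asg_set (M : structure L) (v : var -> carrier M) s x t z :
  asg v s.[x <- t] z = if z == x then teval v t else asg v s z.
Proof. by rewrite /asg /= fnd_set; case: eqP. Qed.

Lemma asg_upd (M : structure L) (v : var -> carrier M) s y d z :
  y \notin rng s -> z \in domf s -> asg [eta v with y |-> d] s z = asg v s z.
Proof.
move=> ys zs; apply: teval_eq => x xz /=; case: eqP => // xy.
by case/rngP: ys; exists z; rewrite -?xy.
Qed.

Lemma sat_fapp_rec (M : structure L) n F s (v : var -> carrier M) :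
    fsize F <= n -> domf s = fv F ->
  sat v (fapp_rec n F s) <-> sat (asg v s) F.
Proof.
elim: n F s v => [|n IHn] F s v; first by case: F.
case: F => [||p a|t u|G|b G H|q x G] /= sz ds.
- by [].
- by [].
- set A := (X in pinterp X); set B := (X in _ <-> pinterp X).
  suff -> : A = B by [].
  by apply/ffunP => i; rewrite !ffunE teval_subst.
- by rewrite !teval_subst.
- by rewrite IHn.
- have step K : fsize K <= n -> fv K `<=` domf s ->
      sat v (fapp_rec n K s.[& fv K]) <-> sat (asg v s) K.
    move=> szK Ks; rewrite IHn //; last first.
      by rewrite domf_restrict; apply/fsetIidPl.
    by apply: sat_eq => z zK; rewrite /asg /= fnd_restrict zK.
  apply: sat_bin; apply: step.
  + by apply: leq_trans (sz : _ <= n); apply: leq_addr.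
  + by rewrite ds fsubsetUl.
  + by apply: leq_trans (sz : _ <= n); apply: leq_addl.
  + by rewrite ds fsubsetUr.
(* Both quantifier cases are instances of [bound]: [y] is the new bound variable, and [H] is the
   body with [y] in the place of [x]. *)
- have bound y H : y \notin rng s ->
      fsize H <= n -> fv H = (if x \in fv G then y |` (fv G `\ x) else fv G) ->
      (x \in fv G -> y \notin fv G `\ x) ->
      (forall u : var -> carrier M,
         sat u H <-> sat [eta u with x |-> u y] G) ->
    sat v (Qu q y (fapp_rec n H (if x \in fv G then s.[y <- Var L y] else s)))
      <-> sat (asg v s) (Qu q x G).
    move=> ys szH fvH yG HG; apply: sat_qu => d; rewrite IHn //; last first.
      rewrite fvH; case: ifP => xG; first by rewrite dom_setf ds.
      by rewrite ds mem_fsetD1 ?xG.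
    rewrite HG; apply: sat_eq => z zG; rewrite /=.
    case: (eqVneq z x) => [zx|zx].
      by rewrite -zx zG asg_set eqxx /= eqxx.
    (* Away from [x], updating [v] at [y] changes nothing because [y] is outside the range of [s].
       The entry for [y], added when [x] is free in [G], does not override that of [z], because [y]
       is then outside [domf s]. *)
    have zs : z \in domf s by rewrite ds !inE zx.
    case: ifP => [/yG|_]; last by rewrite asg_upd.
    rewrite -ds asg_set; case: eqP => [<-|_ _]; first by rewrite zs.
    by rewrite asg_upd.
  case: ifPn => [xs|/negPn xs].
    apply: bound => //.
    + case: ifP => // xG; rewrite fsetD1K //.
    + by rewrite !inE eqxx.
    + by move=> u; apply: sat_eq => z _ /=; case: eqP => [->|].
  (* The first two conditions of [can_rename] are hypotheses of [bound]; [free_for] gives the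
     renamed body the right free variables and the right meaning. *)
  rewrite /rename_var; case: ex_minnP => y /and3P[ys yd yG] _.
  apply: bound => //.
  + by rewrite fsize_frepl.
  + apply/fsetP => z; rewrite mem_fv_frepl //.
    case: ifP => xG; last by rewrite orbF; case: eqVneq => [->|]; rewrite ?xG ?andbT.
    by rewrite !inE /= orbC [in RHS]andbC.
  + by rewrite -ds; apply/implyP.
  + by move=> u; rewrite sat_frepl.
Qed.

(** * Covers of substitutions *)

Section Cover.
Variable M : structure L.
Implicit Types v w : var -> carrier M.

Definition cover s w := exists v, {in domf s, w =1 asg v s}.

(** No term of [s] mentions [y], so giving [y] the value [w x] meets the new entry without
    disturbing the others. *)
Lemma cover_set s x y w : x \notin domf s -> y \notin rng s ->
  cover s.[x <- Var L y] w <-> cover s w.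
Proof.
move=> xs ys; split=> -[v wv].
  exists v => z zs; rewrite wv ?asg_set; last by rewrite dom_setf !inE zs orbT.
  by case: eqP xs => // <-; rewrite zs.
exists [eta v with y |-> w x] => z; rewrite dom_setf !inE asg_set.
by case: eqP => [-> _|_ zs] /=; rewrite ?eqxx // asg_upd // wv.
Qed.

Lemma cover_complete V s w : domf s `<=` V ->
  domf (complete V s) = V /\ (cover (complete V s) w <-> cover s w).
Proof.
move=> sV; rewrite /complete.
(* The induction runs over an arbitrary list of distinct variables that are new to [s] and complete
   its domain to [V]. *)
have : {in sort leq (V `\` domf s), forall x, x \notin domf s}.
  by move=> x; rewrite mem_sort inE => /andP[].
have : uniq (sort leq (V `\` domf s)) by rewrite sort_uniq fset_uniq.
have : V = domf s `|` [fset x in sort leq (V `\` domf s)].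
  apply/fsetP => x; rewrite !inE mem_sort inE.
  by case: (boolP (x \in domf s)) => //= /(fsubsetP sV).
move: (sort leq _) => l; elim: l s {sV} => [|x l IH] s /=.
  by move=> -> _ _; split=> //; apply/fsetP => x; rewrite !inE orbF.
move=> VE /andP[xl ul] ls.
set y := (if _ then _ else _).
have ys : y \notin rng s.
  by rewrite /y; case: ifP => // _; rewrite /first_notin; case: ex_minnP.
have xs : x \notin domf s by apply: ls; rewrite inE eqxx.
have [||z zl|domE cE] := IH s.[x <- Var L y] => //.
- apply/fsetP => z; rewrite VE dom_setf !inE.
  by do !case: (_ \in _); do !case: (_ == _).
- rewrite dom_setf !inE negb_or ls ?inE ?zl ?orbT // andbT.
  by apply: contra xl => /eqP <-.
by split=> //; rewrite cE cover_set.
Qed.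

Lemma cover_regular s r w : regular_extension s r -> cover r w <-> cover s w.
Proof.
case=> rs [h [h_inj hP]].
have sr x : x \in domf s -> r.[? x] = s.[? x].
  by move=> xs; rewrite -[in RHS]rs fnd_restrict xs.
have dsr x : x \in domf s -> x \in domf r.
  by move=> xs; rewrite -fndSome sr // fndSome.
split=> -[v wv].
  by exists v => x xs; rewrite wv ?dsr // /asg /= sr.
pose D := domf r `\` domf s.
(* The assignment inverts [h]: it gives [h x] the value [w x] for each new [x], unambiguously by
   injectivity. Variables in the range of [s] are not of the form [h x], so they keep their
   values. *)
exists (fun y => if [pick x : D | h (val x) == y] is Some x then w (val x) else v y).
move=> x xr; have [xs|xs] := boolP (x \in domf s).
  rewrite wv // /asg /= sr //; apply: teval_eq => y yx.
  case: pickP => // z /eqP hz; have [_] := hP _ (valP z).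
  by rewrite hz => /rngP[]; exists x.
have xD : x \in D by rewrite inE xs.
rewrite /asg /=; have [-> _] := hP _ xD; rewrite /=.
case: pickP => [z /eqP hz|]; first by rewrite (h_inj _ _ (valP z) xD hz).
by move/(_ [` xD]); rewrite /= eqxx.
Qed.

(** If [s'] is [r'] followed by [t], a witness [v] for [s'] yields the witness [asg v t] for
    [r']. *)
Lemma cover_sle s r w : sle s r -> cover s w -> cover r w.
Proof.
case=> s' [r' [t [ss' rr' _ _ s'E]]] /(cover_regular _ ss')[v wv].
apply/(cover_regular _ rr'); exists (asg v t) => x xr.
rewrite wv s'E // [RHS](_ : _ = teval (asg v t) (tsubst r' (Var L x))) //.
rewrite -teval_subst; congr teval; rewrite /=.
by rewrite (in_fnd xr) (@in_fnd _ _ (scomp r' t) _ xr) /= ffunE.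
Qed.

Lemma cover_sequiv s r w : sequiv s r -> cover s w <-> cover r w.
Proof. by case=> sr rs; split; apply: cover_sle. Qed.

Lemma valid_fapp F s :
  valid M (fapp F s) <-> forall w, cover s w -> sat w F.
Proof.
pose s0 := s.[& fv F]; pose r := complete (fv F) s0.
have s0F : domf s0 `<=` fv F by rewrite domf_restrict fsubsetIl.
have [v0] : inhabited (var -> carrier M).
  by case: (carrier_inhabited M) => d; constructor.
have [dr _] := cover_complete v0 s0F.
have rE w : cover r w <-> cover s0 w by have [] := cover_complete w s0F.
split=> [h w [v wv]|h v].
  have /rE[u wu] : cover s0 w.
    exists v => x; rewrite domf_restrict inE => /andP[xF xs].
    by rewrite wv // /asg /= fnd_restrict xF.
  apply: (proj2 (@sat_eq _ F w (asg u r) _)); first by rewrite -dr.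
  by apply: (proj1 (sat_fapp_rec _ (leqnn _) dr)); apply: h.
apply: (proj2 (sat_fapp_rec _ (leqnn _) dr)).
have /rE[u wu] : cover r (asg v r) by exists v.
(* Restricting [s] to [fv F] may enlarge its cover. Gluing [asg v r] on the free variables with
   [asg u s] elsewhere gives a member of the cover of [s] itself on which [F] has the same truth
   value. *)
pose w x := if x \in fv F then asg v r x else asg u s x.
apply: (proj1 (@sat_eq _ F w _ _)) => [x xF|]; first by rewrite /w xF.
apply: h; exists u => x xs; rewrite /w; case: ifP => // xF.
rewrite wu; first by rewrite /asg /= fnd_restrict xF.
by rewrite domf_restrict inE xF.
Qed.

(** * Solved forms and corresponding substitutions *)

Lemma fv_exs zs F x : (x \in fv (exs zs F)) = (x \in fv F) && (x \notin zs).
Proof.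
elim: zs => [|z zs IH] /=; first by rewrite andbT.
by rewrite !inE IH negb_or andbCA.
Qed.

Lemma fv_conj_eqs (eqs : seq (var * term L)) x t :
  List.In (x, t) eqs -> x |` tvars t `<=` fv (conj_eqs eqs).
Proof.
rewrite /conj_eqs; elim: eqs => [//|[y u] [|e eqs] IH] /=.
  by case=> // -[-> ->].
case=> [[-> ->]|/IH xt]; first exact: fsubsetUl.
exact: fsubset_trans xt (fsubsetUr _ _).
Qed.

Lemma fnd_eqs (eqs : seq (var * term L)) r x t :
    uniq (unzip1 eqs) -> List.In (x, t) eqs ->
  (foldr (fun e r => r.[e.1 <- e.2]) r eqs).[? x] = Some t.
Proof.
elim: eqs => //= -[y u] eqs IH /= /andP[yeqs ueqs] [[-> ->]|xt].
  by rewrite fnd_set eqxx.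
rewrite fnd_set; case: eqP => [xy|_]; last exact: IH.
case/negP: yeqs; rewrite -xy.
by elim: eqs xt {IH ueqs} => //= e eqs IH [->|/IH xe]; rewrite inE ?eqxx ?xe ?orbT.
Qed.

Lemma fnd_eqs_out (eqs : seq (var * term L)) r x : x \notin unzip1 eqs ->
  (foldr (fun e r => r.[e.1 <- e.2]) r eqs).[? x] = r.[? x].
Proof.
elim: eqs => //= e eqs IH; rewrite inE negb_or => /andP[xe xeqs].
by rewrite fnd_set (negbTE xe) IH.
Qed.

Lemma in_unzip1 (eqs : seq (var * term L)) x :
  reflect (exists t, List.In (x, t) eqs) (x \in unzip1 eqs).
Proof.
elim: eqs => [|[y u] eqs IH] /=; first by right; case.
rewrite inE; apply: (iffP orP) => [[/eqP ->|/IH[t xt]]|[t [[-> _]|xt]]].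
- by exists u; left.
- by exists t; right.
- by left.
- by right; apply/IH; exists t.
Qed.

Lemma cover_solved zs (eqs : seq (var * term L)) w : solved zs eqs ->
  cover (solved_subst zs eqs) w <-> sat w (exs zs (conj_eqs eqs)).
Proof.
case=> _; rewrite cat_uniq => /and3P[_ /hasPn zsx ux] xt _ _.
set P := parameters zs eqs.
set r := solved_subst zs eqs.
have PE x : (x \in P) =
    [&& x \notin unzip1 eqs, x \in fv (conj_eqs eqs) & x \notin zs].
  by rewrite /P /parameters 2!inE fv_exs.
have asg_eqs v x t : List.In (x, t) eqs -> asg v r x = teval v t.
  by move=> xe; rewrite /asg /= /r /solved_subst (fnd_eqs _ ux xe).
have rP x : x \notin unzip1 eqs ->
    r.[? x] = if x \in P then Some (Var L x) else None.
  move=> xe; rewrite /r /solved_subst fnd_eqs_out // -/P; case: ifP => xP.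
    by rewrite (in_fnd (xP : x \in domf [fmap y : P => Var L (val y)])) ffunE.
  by rewrite not_fnd // xP.
have domr x : (x \in domf r) = (x \in unzip1 eqs) || (x \in P).
  have [/in_unzip1[t xe]|xe] /= := boolP (x \in unzip1 eqs).
    by rewrite -fndSome /r /solved_subst (fnd_eqs _ ux xe).
  by rewrite -fndSome rP //; case: ifP.
have asgP v x : x \in P -> asg v r x = v x.
  by move=> xP; move: (xP); rewrite PE => /andP[xe _]; rewrite /asg /= rP // xP.
rewrite sat_exs; split=> [[v wv]|[v vw /sat_conj_eqs eqv]].
  (* The witness [v] supplies the values of the quantified variables. *)
  exists (fun x => if x \in zs then v x else w x).
    by move=> x; rewrite !inE => /negbTE ->.
  apply/sat_conj_eqs => x t xe.
  have xe1 : x \in unzip1 eqs by apply/in_unzip1; exists t.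
  rewrite (negbTE (zsx _ xe1)) wv ?domr ?xe1 // (asg_eqs _ _ _ xe).
  apply: teval_eq => y yt; case: ifPn => // yzs.
  (* By solvedness no variable of a right-hand side is also a left-hand side, so one outside [zs] is
     a parameter, and there [w] agrees with [v]. *)
  have yP : y \in P.
    rewrite PE yzs andbT; apply/andP; split.
      apply/negP => /xt /(_ (List.in_map snd _ _ xe)).
      by rewrite yt.
    by apply: (fsubsetP (fv_conj_eqs xe)); rewrite inE yt orbT.
  by rewrite wv ?domr ?yP ?orbT // asgP.
(* A solution [v] of the equations is itself a witness: left-hand sides and parameters lie outside
   [zs], where [v] agrees with [w]. *)
exists v => x; rewrite domr => /orP[xe|xP].
  case/in_unzip1: (xe) => t xte.
  rewrite (asg_eqs _ _ _ xte) -(eqv _ _ xte) vw //.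
  by rewrite !inE; apply: zsx.
by rewrite asgP // vw // !inE; move: xP; rewrite PE => /and3P[].
Qed.

Lemma cover_corresponds s E w : (forall A, FEA L A -> valid M A) ->
  corresponds s E -> cover s w <-> sat w E.
Proof.
move=> MA [[ET /cover_sequiv ->]|[zs [eqs [sol EE /cover_sequiv ->]]]].
  have [_ h] := ET M MA w; split=> [_|_]; first exact: h.
  by exists w.
by rewrite cover_solved //; have := EE M MA w; rewrite /=; tauto.
Qed.

End Cover.

(** Stated for each model separately, this yields both the equivalence of the two entailments and
    the entailed equivalence of the closures. *)
Lemma valid_fapp_corresponds (M : structure L) s E F :
    (forall A, FEA L A -> valid M A) -> corresponds s E ->
  valid M (fapp F s) <-> valid M (Bin Imp E F).
Proof.
move=> MA sE; rewrite valid_fapp.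
by split=> h w /(cover_corresponds w MA sE); apply: h.
Qed.

End Semantics.

Theorem theorem5p23 (L : language)
    (hconst : exists c : fun_sym L, fun_ar c = 0)
    (F E : formula L) (hE : Eformula E)
    (s : subst L) (hs : corresponds s E) :
  (entails (FEA L) (fapp F s) <-> entails (FEA L) (Bin Imp E F)) /\
  entails (FEA L) (Bin Iff (uclosure (fapp F s)) (uclosure (Bin Imp E F))).
Proof.
split.
  by split=> h M MA; apply/(valid_fapp_corresponds F MA hs); apply: h.
move=> M MA v; have := valid_fapp_corresponds F MA hs.
have := sat_uclosure v (fapp F s); have := sat_uclosure v (Bin Imp E F).
rewrite [sat v (Bin Iff _ _)]/=; tauto.
Qed.
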